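(* Let $n\ge 3$, let $a_0,\ldots,a_{n-1}$ be indeterminates over $\mathbb{Q}$, $f=x^n+a_{n-1}x^{n-1}+\cdots+a_0$, \[f_1(x,y)=\frac{f(y)-f(x)}{y-x},\qquad f_3(x,y)=\frac{f(y)-2f\left(\frac{x+y}{2}\right)+f(x)}{\frac{(y-x)^2}{2}},\] and $F=\operatorname{res}(f_1,f_3,y)$. Then $\deg(F,x)=(n-1)(n-2)$.
   Context: The quotients are polynomials in $x,y$; $\operatorname{res}(\cdot,\cdot,y)$ is the Sylvester resultant with respect to $y$. *)

(* Defs.v *)
From HB Require Import structures.
From mathcomp Require Import all_boot all_order all_algebra.
From mathcomp Require Import mpoly.
Unset Printing Implicit Defensive.
Import GRing.Theory.
Local Open Scope ring_scope.

(* Coefficient ring: Q[a_0, ..., a_(n-1)], the a_i being the mpoly variables 'X_i. *)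
Notation coefR n := {mpoly rat[n]}.

Definition gen_f (n : nat) : {poly coefR n} :=
  'X^n + \sum_(i < n) ('X_i)%:P * 'X^i.

(* Bivariate polynomials: {poly {poly coefR n}}; outer variable is y, inner is x. *)
Definition varX2 (n : nat) : {poly {poly coefR n}} := ('X)%:P.
Definition varY2 (n : nat) : {poly {poly coefR n}} := 'X.

Definition f_at (n : nat) (t : {poly {poly coefR n}}) : {poly {poly coefR n}} :=
  (map_poly (fun c : coefR n => c%:P%:P) (gen_f n)).[t].

Definition half2 (n : nat) : {poly {poly coefR n}} := (mpolyC n ((2%:R : rat)^-1))%:P%:P.

(* f_1 = (f(y) - f(x)) / (y - x)   (exact polynomial quotient) *)
Definition f1 (n : nat) : {poly {poly coefR n}} :=
  divp (f_at n (varY2 n) - f_at n (varX2 n)) (varY2 n - varX2 n).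

(* f_3 = (f(y) - 2 f((x+y)/2) + f(x)) / ((y-x)^2 / 2)   (exact polynomial quotient) *)
Definition f3 (n : nat) : {poly {poly coefR n}} :=
  2%:R * divp (f_at n (varY2 n) - 2%:R * f_at n (half2 n * (varX2 n + varY2 n))
                + f_at n (varX2 n)) ((varY2 n - varX2 n) ^+ 2).

Definition resF (n : nat) : {poly coefR n} := resultant (f1 n) (f3 n).

(* Main.v *)
Require Import Defs.
From HB Require Import structures.
From mathcomp Require Import all_boot all_order all_fingroup all_algebra all_field.
From mathcomp Require Import mpoly.
From mathcomp Require Import zify ring.
Set Implicit Arguments.
Unset Strict Implicit.
Unset Printing Implicit Defensive.
Import Order.TTheory GRing.Theory Num.Theory.
Local Open Scope ring_scope.

(* Give x and y weight 1.  Then f_1 and f_3 have total degree n - 1 and n - 2,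
   so by the Leibniz expansion of the Sylvester determinant F has degree at most
   (n - 1)(n - 2) in x, and its coefficient in that degree is the resultant of
   the homogeneous parts of top degree, dehomogenized at x = 1.  These come from
   f = x^n alone: they are (y^n - 1) / (y - 1) and
   2 (y^n - 2 ((1 + y) / 2)^n + 1) / (y - 1)^2.  A common complex root z would
   satisfy z <> 1 and z^n = ((1 + z) / 2)^n = 1, hence |z| = 1 and
   |1 + z| = 2 = 1 + |z|, which is the equality case of the triangle inequality
   and forces z = 1.  So the top coefficient is a nonzero rational number. *)

(** * Divided differences of powers and of monic polynomials *)

Section DividedDifferences.
Variable A : comNzRingType.
Implicit Types x y h : A.

Definition pow_diff k x y : A := \sum_(i < k) x ^+ (k.-1 - i) * y ^+ i.

(* Second divided difference of t^k at x, h (x + y), y, meant for h = 1/2. *)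
Definition pow_diff2 k x y h : A :=
  \sum_(i < k) pow_diff (k.-1 - i) y x * (h * (x + y)) ^+ i.

Lemma pow_diffE k x y : x ^+ k - y ^+ k = (x - y) * pow_diff k x y.
Proof. exact: subrXX. Qed.

(** The midpoint u satisfies y - u = h (y - x) = - (x - u), so the left side is h (y - x) times the
    difference of two first divided differences, and that difference is again divisible by y - x,
    term by term. *)
Lemma pow_diff2E k x y h : 2%:R * h = 1 ->
  y ^+ k - 2%:R * (h * (x + y)) ^+ k + x ^+ k
    = (y - x) ^+ 2 * (h * pow_diff2 k x y h).
Proof.
move=> h2; set u := h * (x + y).
have yuE : y - u = h * (y - x).
  by rewrite /u -[X in X - _]mul1r -h2; ring.
have xuE : x - u = - (h * (y - x)).
  by rewrite /u -[X in X - _]mul1r -h2; ring.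
have -> : y ^+ k - 2%:R * u ^+ k + x ^+ k
    = (y ^+ k - u ^+ k) + (x ^+ k - u ^+ k) by ring.
rewrite !pow_diffE yuE xuE.
have -> : (y - x) ^+ 2 * (h * pow_diff2 k x y h)
    = h * (y - x) * ((y - x) * pow_diff2 k x y h) by ring.
rewrite mulNr -mulrBr; congr (_ * _).
rewrite /pow_diff2 -/u mulr_sumr -sumrB; apply: eq_bigr => i _.
by rewrite mulrA -pow_diffE mulrBl.
Qed.

Variables (n : nat) (c : 'I_n -> A).
Let f (t : A) : A := t ^+ n + \sum_(i < n) c i * t ^+ i.

Lemma poly_pow_diffE x y :
  f x - f y = (x - y) * (pow_diff n x y + \sum_(i < n) c i * pow_diff i x y).
Proof.
rewrite /f opprD addrACA -sumrB mulrDr -pow_diffE mulr_sumr; congr (_ + _).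
by apply: eq_bigr => i _; rewrite -mulrBr pow_diffE mulrCA.
Qed.

Lemma poly_pow_diff2E x y h : 2%:R * h = 1 ->
  f y - 2%:R * f (h * (x + y)) + f x
    = (y - x) ^+ 2
      * (h * (pow_diff2 n x y h + \sum_(i < n) c i * pow_diff2 i x y h)).
Proof.
move=> h2.
have sumE : (y - x) ^+ 2 * (h * \sum_(i < n) c i * pow_diff2 i x y h)
    = \sum_(i < n) c i * y ^+ i - 2%:R * (\sum_(i < n) c i * (h * (x + y)) ^+ i)
      + \sum_(i < n) c i * x ^+ i.
  rewrite !mulr_sumr -sumrB -big_split /=; apply: eq_bigr => i _.
  by rewrite (mulrCA h) (mulrCA _ (c i)) -pow_diff2E //; ring.
by rewrite (mulrDr h (pow_diff2 _ _ _ _)) (mulrDr (_ ^+ 2) (h * _)) sumE -pow_diff2E // /f; ring.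
Qed.

End DividedDifferences.

Lemma rmorph_pow_diff (A B : comNzRingType) (f : {rmorphism A -> B}) k x y :
  f (pow_diff k x y) = pow_diff k (f x) (f y).
Proof.
by rewrite rmorph_sum; apply: eq_bigr => i _; rewrite rmorphM !rmorphXn.
Qed.

Lemma rmorph_pow_diff2 (A B : comNzRingType) (f : {rmorphism A -> B}) k x y h :
  f (pow_diff2 k x y h) = pow_diff2 k (f x) (f y) (f h).
Proof.
rewrite rmorph_sum; apply: eq_bigr => i _.
by rewrite rmorphM rmorphXn rmorphM rmorphD rmorph_pow_diff.
Qed.

(** * Top-degree parts of determinants and of bivariate polynomials *)

Section TopForms.
Variable R : comNzRingType.
Implicit Types (p q : {poly R}) (P Q : {poly {poly R}}).

Lemma coefM_top p q a b : (size p <= a.+1)%N -> (size q <= b.+1)%N ->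
  (p * q)`_(a + b) = p`_a * q`_b.
Proof.
move=> sp sq; rewrite coefM (bigD1 (inord a)) //= inordK ?ltnS ?leq_addr //.
rewrite addKn big1 ?addr0 // => i /eqP ia.
have {}ia : (i : nat) <> a by move=> E; apply: ia; apply: val_inj; rewrite /= inordK ?E // ltnS leq_addr.
have [lt_ai|le_ia] := ltnP a i; first by rewrite [p`_i]nth_default ?mul0r // (leq_trans sp).
by rewrite [q`_ _]nth_default ?mulr0 // (leq_trans sq) //; lia.
Qed.

Lemma prod_top (I : finType) (F : I -> {poly R}) (m : I -> nat) :
  (forall i, size (F i) <= (m i).+1)%N ->
  (size (\prod_i F i)%R <= (\sum_i m i).+1)%N
  /\ (\prod_i F i)`_(\sum_i m i)%N = \prod_i (F i)`_(m i).
Proof.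
move=> sF; elim/big_rec3: _ => [|i q d p _ [IHs IHc]].
  by rewrite size_poly1 coef1.
split; last by rewrite coefM_top // IHc.
by apply: leq_trans (size_polyMleq _ _) _; have := sF i; lia.
Qed.

(* The subtraction in [(r i).+1 - j] is truncated: the bound forces [A i j = 0]
   as soon as [j] exceeds [r i]. *)
Lemma det_top N (A : 'M[{poly R}]_N) (r : 'I_N -> nat) D :
  (\sum_i r i = D + \sum_(j < N) j)%N ->
  (forall i j : 'I_N, size (A i j) <= (r i).+1 - j)%N ->
  (size (\det A) <= D.+1)%N
  /\ (\det A)`_D = \det (\matrix_(i, j) (A i j)`_(r i - j)).
Proof.
move=> sumr sA.
have term (s : 'S_N) : (size (\prod_i A i (s i))%R <= D.+1)%N
    /\ (\prod_i A i (s i))`_D = \prod_i (A i (s i))`_(r i - s i).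
  (* If some [s i] exceeds [r i], the entry there is zero, and the product vanishes on both
     sides. *)
  have [/forallP le_sr|] := boolP [forall i, s i <= r i]%N; last first.
    rewrite negb_forall => /existsP[i lt_ri].
    have A0 : A i (s i) = 0.
      by apply/eqP; rewrite -size_poly_eq0; have := sA i (s i); lia.
    by rewrite (bigD1 i) //= [RHS](bigD1 i) //= A0 !mul0r !coef0 mul0r size_poly0.
  (* Since [s] permutes the columns, the column weights have the same sum for every [s]. *)
  have sumD : (\sum_i (r i - s i) = D)%N.
    have : (\sum_i (r i - s i) + \sum_i (s i : nat) = \sum_i r i)%N.
      by rewrite -big_split /=; apply: eq_bigr => i _; rewrite subnK.
    rewrite sumr [X in (_ = _ + X)%N](reindex_inj (@perm_inj _ s)) /=.
    by move/addIn.
  rewrite -sumD; apply: prod_top => i.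
  by have := sA i (s i); have := le_sr i; lia.
split.
  apply: (leq_trans (size_sum _ _ _)); apply/bigmax_leqP => s _.
  by case: (odd_perm s) => /=;
    rewrite ?expr1 ?expr0 ?mulN1r ?mul1r ?size_polyN; case: (term s).
rewrite coef_sum; apply: eq_bigr => s _.
case: (odd_perm s) => /=;
  rewrite ?expr1 ?expr0 ?mulN1r ?mul1r ?coefN; case: (term s) => _ ->;
  [congr (- _)|]; by apply: eq_bigr => i _; rewrite mxE.
Qed.

(* [P] has total degree at most [D] and its homogeneous part of degree [D],
   dehomogenized at x = 1, is [p]. *)
Definition has_top D P p :=
  forall j, (size (P`_j)%R <= D.+1 - j)%N /\ p`_j = P`_j`_(D - j).

Lemma has_top0 D : has_top D 0 0.
Proof. by move=> j; rewrite !coef0 size_poly0. Qed.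

Lemma has_topD D P Q p q : has_top D P p -> has_top D Q q ->
  has_top D (P + Q) (p + q).
Proof.
move=> tP tQ j; have [sP cP] := tP j; have [sQ cQ] := tQ j.
by rewrite !coefD cP cQ; split=> //; apply: leq_trans (size_polyD _ _) _; lia.
Qed.

Lemma has_top_sum (I : Type) (s : seq I) (B : pred I) D
    (F : I -> {poly {poly R}}) (f : I -> {poly R}) :
  (forall i, B i -> has_top D (F i) (f i)) ->
  has_top D (\sum_(i <- s | B i) F i) (\sum_(i <- s | B i) f i).
Proof.
by move=> tF; elim/big_rec2: _ => [|i P p Bi]; [apply: has_top0|apply/has_topD/tF].
Qed.

Lemma has_top_sum0 (I : Type) (s : seq I) (B : pred I) D
    (F : I -> {poly {poly R}}) :
  (forall i, B i -> has_top D (F i) 0) -> has_top D (\sum_(i <- s | B i) F i) 0.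
Proof.
move=> tF; elim/big_ind: _ => // [|P Q tP tQ]; first exact: has_top0.
by rewrite -[0]addr0; apply: has_topD.
Qed.

Lemma has_topM D E P Q p q : has_top D P p -> has_top E Q q ->
  has_top (D + E) (P * Q) (p * q).
Proof.
move=> tP tQ j; rewrite !coefM; split.
  apply: (leq_trans (size_sum _ _ _)); apply/bigmax_leqP => i _.
  have [sP _] := tP i; have [sQ _] := tQ (j - i)%N.
  (* Nonzero factors force i <= D and j - i <= E, so no subtraction is truncated and the two bounds
     add up. *)
  have [->|nzP] := eqVneq P`_i 0; first by rewrite mul0r size_poly0.
  have [->|nzQ] := eqVneq Q`_(j - i) 0; first by rewrite mulr0 size_poly0.
  move: nzP nzQ; rewrite -!size_poly_gt0 => nzP nzQ.
  by apply: leq_trans (size_polyMleq _ _) _; have := ltn_ord i; lia.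
rewrite coef_sum; apply: eq_bigr => i _.
have [sP ->] := tP i; have [sQ ->] := tQ (j - i)%N.
have [lt_Di|le_iD] := ltnP D i.
  have -> : P`_i = 0 by apply/eqP; rewrite -size_poly_eq0; lia.
  by rewrite mul0r !coef0 mul0r.
have [lt_Ej|le_jE] := ltnP E (j - i).
  have -> : Q`_(j - i) = 0 by apply/eqP; rewrite -size_poly_eq0; lia.
  by rewrite mulr0 !coef0 mulr0.
rewrite -coefM_top; [congr (_`_ _)|..]; have := ltn_ord i; lia.
Qed.

(** This discards the terms of f_1 and f_3 that involve some a_i. *)
Lemma has_top_lower D E P p : (D < E)%N -> has_top D P p -> has_top E P 0.
Proof.
move=> ltDE tP j; have [sP _] := tP j; split; first lia.
by rewrite coef0 nth_default // (leq_trans sP) //; lia.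
Qed.

Lemma has_topC (c : R) : has_top 0 c%:P%:P c%:P.
Proof.
move=> j; rewrite !coefC; case: j => [|j] /=; last by rewrite size_poly0 coef0.
by rewrite coefC size_polyC; case: eqP.
Qed.

Lemma has_top_x : has_top 1 'X%:P 1.
Proof.
move=> j; rewrite coefC coef1; case: j => [|j] /=.
  by rewrite coefX size_polyX.
by rewrite size_poly0 coef0.
Qed.

Lemma has_top_y : has_top 1 'X 'X.
Proof.
move=> j; rewrite !coefX; case: j => [|[|j]] /=; rewrite ?size_poly0 ?coef0 //.
by rewrite size_poly1 coef1.
Qed.

Lemma has_topX P p k : has_top 1 P p -> has_top k (P ^+ k) (p ^+ k).
Proof.
move=> tP; elim: k => [|k IHk]; last by rewrite !exprS -add1n; apply: has_topM.
by rewrite !expr0; apply: (has_topC 1).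
Qed.

Lemma has_top_pow_diff k P Q p q : has_top 1 P p -> has_top 1 Q q ->
  has_top k.-1 (pow_diff k P Q) (pow_diff k p q).
Proof.
move=> tP tQ; apply: has_top_sum => i _.
rewrite -[X in has_top X](@subnK i); last by have := ltn_ord i; lia.
by apply: has_topM; apply: has_topX.
Qed.

Lemma has_top_pow_diff2 k P Q p q c : has_top 1 P p -> has_top 1 Q q ->
  has_top k.-2 (pow_diff2 k P Q c%:P%:P) (pow_diff2 k p q c%:P).
Proof.
move=> tP tQ; apply: has_top_sum => i _.
(* For i = k.-1 the inner divided difference is an empty sum; this zero term is set apart because
   its degrees would add up to k.-1. *)
have [ltik|] := ltnP i k.-1; last first.
  rewrite -subn_eq0 => /eqP->.
  by rewrite /pow_diff !big_ord0 !mul0r; apply: has_top0.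
have -> : k.-2 = ((k.-1 - i).-1 + i)%N by lia.
apply: has_topM; first exact: has_top_pow_diff.
apply/has_topX/(has_topM (has_topC c)); exact: has_topD.
Qed.

Lemma has_top_size D P p : has_top D P p -> p`_D != 0 -> size P = D.+1.
Proof.
move=> tP nzp; apply/eqP; rewrite eqn_leq; apply/andP; split.
  apply/leq_sizeP => j ltDj; apply/eqP; rewrite -size_poly_eq0.
  by have [] := tP j; lia.
rewrite ltnNge; apply: contra nzp => sP.
by have [_ ->] := tP D; rewrite [P`_D]nth_default ?coef0.
Qed.

Lemma has_top_size_form D P p : has_top D P p -> p`_D != 0 -> size p = D.+1.
Proof.
move=> tP nzp; apply/eqP; rewrite eqn_leq; apply/andP; split.
  apply/leq_sizeP => j ltDj; have [sP ->] := tP j.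
  have -> : P`_j = 0 by apply/eqP; rewrite -size_poly_eq0; lia.
  by rewrite coef0.
rewrite ltnNge; apply: contra nzp => sp; by rewrite nth_default.
Qed.

End TopForms.

(** * Degree of a Sylvester resultant *)

(** Indexing by natural numbers lets matrices of different polynomials be compared entrywise. The
    factors [*+] kill the entries where the subtraction is truncated. *)
Definition sylvester_entry (R : nzRingType) (p q : {poly R}) e (i j : nat) : R :=
  if (i < e)%N then p`_(j - i) *+ (i <= j) else q`_(j - (i - e)) *+ (i - e <= j).

Lemma resultantE (R : nzRingType) (p q : {poly R}) d e :
  size p = d.+1 -> size q = e.+1 ->
  resultant p q = \det (\matrix_(i < e + d, j < e + d) sylvester_entry p q e i j).
Proof.
move=> sp sq; rewrite /resultant.
have -> : Sylvester_mx p q = \matrix_(i, j) sylvester_entry p q (size q).-1 i j.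
  apply/matrixP => i j; rewrite Sylvester_mxE mxE /sylvester_entry.
  by case: splitP => k ->; rewrite ?addKn.
by rewrite sp sq.
Qed.

(** In column j, an entry of a p-row i has degree at most d - (j - i) = (d + i) - j, and one of a
    q-row i at most e - (j - (i - e)) = i - j. The e rows of p supply the excess d e. *)
Lemma sum_sylvester_weights d e :
  (\sum_(i < e + d) (if i < e then d + i else i)
    = d * e + \sum_(j < e + d) j)%N.
Proof.
rewrite !big_split_ord /= addnA; congr (_ + _)%N.
  under eq_bigr do rewrite ltn_ord.
  by rewrite big_split /= sum_nat_const card_ord mulnC.
by apply: eq_bigr => i _; rewrite ltnNge leq_addr.
Qed.

Lemma size_resultant_top (R : comNzRingType) (P Q : {poly {poly R}}) p q d e :
  has_top d P p -> has_top e Q q -> p`_d != 0 -> q`_e != 0 ->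
  resultant p q != 0 -> size (resultant P Q) = (d * e).+1.
Proof.
move=> tP tQ nzp nzq.
rewrite (resultantE (has_top_size_form tP nzp) (has_top_size_form tQ nzq)) => nzr.
rewrite (resultantE (has_top_size tP nzp) (has_top_size tQ nzq)).
set A := \matrix_(i < e + d, j < e + d) sylvester_entry P Q e i j.
pose r (i : 'I_(e + d)) := if (i < e)%N then (d + i)%N else i : nat.
have sA (i j : 'I_(e + d)) : (size (A i j) <= (r i).+1 - j)%N.
  rewrite mxE /sylvester_entry /r !mulrb; case: ltnP => [lt_ie|le_ei].
    case: (leqP i j) => lij; rewrite ?size_poly0 //.
    by have [sP _] := tP (j - i)%N; rewrite (leq_trans sP) //; lia.
  case: (leqP (i - e) j) => lij; rewrite ?size_poly0 //.
  by have [sQ _] := tQ (j - (i - e))%N; rewrite (leq_trans sQ) //; lia.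
have [sD cD] := det_top (sum_sylvester_weights d e) sA.
(* A smaller degree would annihilate the coefficient of index [d * e], which is the determinant of
   the Sylvester matrix of p and q. *)
apply/eqP; rewrite eqn_leq sD ltnNge; apply: contra nzr => sD'.
apply/eqP; rewrite -[RHS](nth_default 0 sD') cD; congr (\det _).
apply/matrixP => i j; rewrite !mxE /sylvester_entry /r !mulrb.
case: ltnP => [lt_ie|le_ei]; (case: ifP => lij; rewrite ?coef0 //).
  by have [_ ->] := tP (j - i)%N; congr (_`_ _); lia.
by have [_ ->] := tQ (j - (i - e))%N; congr (_`_ _); lia.
Qed.

(** * Explicit forms of the quotients f_1 and f_3 *)

Lemma f_atE n t :
  f_at n t = t ^+ n + \sum_(i < n) ('X_i : coefR n)%:P%:P * t ^+ i.
Proof.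
rewrite /f_at -[map_poly _ _]/(map_poly (polyC \o polyC) (gen_f n)) /gen_f.
rewrite rmorphD rmorph_sum /= map_polyXn hornerD hornerXn horner_sum.
congr (_ + _); apply: eq_bigr => i _.
by rewrite rmorphM /= map_polyC map_polyXn hornerCM hornerXn.
Qed.

(** The divisor y - x is monic in y, so [divp] cancels it exactly. *)
Lemma f1E n :
  f1 n = pow_diff n (varY2 n) (varX2 n)
    + \sum_(i < n) ('X_i : coefR n)%:P%:P * pow_diff i (varY2 n) (varX2 n).
Proof.
rewrite /f1 !f_atE poly_pow_diffE; apply: Pdiv.IdomainMonic.mulKp.
exact: monicXsubC.
Qed.

Lemma mul2_half (A : comNzRingType) (f : {rmorphism rat -> A}) :
  2%:R * f 2%:R^-1 = 1.
Proof. by rewrite -(rmorph_nat f) -rmorphM divff ?rmorph1. Qed.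

Lemma mul2_half2 n : 2%:R * half2 n = 1.
Proof. exact: (mul2_half (polyC \o (polyC \o @mpolyC n rat))). Qed.

Lemma mul2_divp_half (R : idomainType) (d h q : {poly R}) :
  d \is monic -> 2%:R * h = 1 -> 2%:R * divp (d * (h * q)) d = q.
Proof. by move=> md h2; rewrite Pdiv.IdomainMonic.mulKp // mulrA h2 mul1r. Qed.

Lemma f3E n :
  f3 n = pow_diff2 n (varX2 n) (varY2 n) (half2 n)
    + \sum_(i < n) ('X_i : coefR n)%:P%:P
                   * pow_diff2 i (varX2 n) (varY2 n) (half2 n).
Proof.
rewrite /f3 !f_atE poly_pow_diff2E ?mul2_half2 //; apply: mul2_divp_half.
  exact/monic_exp/monicXsubC.
exact: mul2_half2.
Qed.

(** * Top forms of f_1 and f_3 *)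

(** Here ['X] stands for y, and x is set to 1. Rational coefficients allow a passage both to
    [coefR n] and to [algC]. *)
Definition top_f1 n : {poly rat} := pow_diff n 'X 1.
Definition top_f3 n : {poly rat} := pow_diff2 n 1 'X (2%:R^-1)%:P.

Lemma has_top_f1 n : (1 < n)%N ->
  has_top n.-1 (f1 n) (map_poly (@mpolyC n rat) (top_f1 n)).
Proof.
move=> n1; rewrite f1E -[map_poly _ _]addr0; apply: has_topD.
  rewrite rmorph_pow_diff rmorph1 /= map_polyX.
  exact: has_top_pow_diff (has_top_y _) (has_top_x _).
apply: has_top_sum0 => i _.
(* Each a_i has degree 0. For i = 0 the predecessor is truncated, and 1 < n gives the strict
   inequality. *)
apply: (@has_top_lower _ (0 + i.-1)); first by have := ltn_ord i; lia.
apply: has_topM (has_topC _) (has_top_pow_diff _ (has_top_y _) (has_top_x _)).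
Qed.

Lemma has_top_f3 n : (2 < n)%N ->
  has_top n.-2 (f3 n) (map_poly (@mpolyC n rat) (top_f3 n)).
Proof.
move=> n2; rewrite f3E -[map_poly _ _]addr0; apply: has_topD.
  rewrite rmorph_pow_diff2 rmorph1 /= map_polyX map_polyC.
  exact: has_top_pow_diff2 (has_top_x _) (has_top_y _).
apply: has_top_sum0 => i _.
apply: (@has_top_lower _ (0 + i.-2)); first by have := ltn_ord i; lia.
apply: has_topM (has_topC _) (has_top_pow_diff2 _ _ (has_top_x _) (has_top_y _)).
Qed.

(** * Coprimality of the top forms *)

(* On the unit circle |(1 + z) / 2| < 1 unless z = 1. *)
Lemma unity_root_midpoint (C : numClosedFieldType) n (z : C) : (0 < n)%N ->
  z ^+ n = 1 -> (2%:R^-1 * (1 + z)) ^+ n = 1 -> z = 1.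
Proof.
move=> n0 zn un.
have norm1 (w : C) : w ^+ n = 1 -> `|w| = 1.
  move=> wn; apply/eqP; rewrite -(@pexpr_eq1 _ _ n) //.
  by rewrite -normrX wn normr1.
have z1 := norm1 _ zn; have := norm1 _ un.
rewrite normrM normfV normr_nat => /(congr1 ( *%R 2%:R)).
rewrite mulrA divff ?pnatr_eq0 // mul1r mulr1 => u2.
have {}u2 : `|1 + z| = `|1| + `|z| by rewrite normr1 z1 u2.
(* In the equality case 1 and z are their moduli times a common t; both moduli are 1. *)
have [t _ []] := normCDeq u2.
by rewrite normr1 z1 !mul1r => -> ->.
Qed.

Lemma coprimep_top_f1_f3 n : (0 < n)%N -> coprimep (top_f1 n) (top_f3 n).
Proof.
move=> n0; apply/negPn/negP; rewrite coprimep_def => sg.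
have [z] : exists z, root (map_poly (ratr : rat -> algC) (gcdp (top_f1 n) (top_f3 n))) z.
  by apply/closed_rootP; rewrite size_map_poly.
rewrite gcdp_map root_gcd /top_f1 /top_f3 => /andP[].
rewrite rmorph_pow_diff rmorph_pow_diff2 /= rmorph1 map_polyX map_polyC /=.
rewrite !rootE -!/(horner_eval z _) rmorph_pow_diff rmorph_pow_diff2 /=.
rewrite /horner_eval !hornerE fmorphV rmorph_nat => /eqP r1 /eqP r3.
have zn : z ^+ n = 1.
  by apply/eqP; rewrite -subr_eq0 -[X in _ - X](expr1n _ n) pow_diffE r1 mulr0.
have z1 : z = 1.
  apply: (unity_root_midpoint n0 zn).
  (* As z is a root of the second form and z^n = 1, this identity becomes 1 - 2 ((1 + z) / 2)^n + 1
     = 0. *)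
  have := @pow_diff2E algC n 1 z 2%:R^-1 (divff _).
  rewrite r3 !mulr0 zn expr1n pnatr_eq0 => /(_ isT) u0.
  apply: (@mulfI _ 2%:R); first by rewrite pnatr_eq0.
  by apply/eqP; rewrite eq_sym -subr_eq0 -u0; apply/eqP; ring.
(* The first form takes the value n at 1, which is nonzero. *)
move: r1; rewrite z1 /pow_diff; under eq_bigr do rewrite !expr1n mulr1.
by rewrite sumr_const card_ord => /eqP; rewrite pnatr_eq0 gtn_eqF.
Qed.

(** * Leading coefficients of the top forms *)

Lemma top_f1_lead n : (0 < n)%N -> (top_f1 n)`_n.-1 = 1.
Proof.
case: n => // n _; rewrite /top_f1 /pow_diff coef_sum big_ord_recl.
rewrite subn0 expr0 mulr1 coefXn eqxx big1 ?addr0 // => i _.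
rewrite expr1n mulr1 coefXn /=; case: eqP => //.
by rewrite /bump /=; have := ltn_ord i; lia.
Qed.

(** Comparing coefficients of y^n in the identity of [pow_diff2E] shows that half of this
    coefficient is 1 - 2 / 2^n; it vanishes only if 2^n = 2. *)
Lemma top_f3_lead n : (1 < n)%N -> (top_f3 n)`_n.-2 != 0.
Proof.
move=> n1; set c : rat := 2%:R^-1.
have sg3 : (size (top_f3 n) <= n.-2.+1)%N.
  apply/leq_sizeP => j ltj.
  have [sP ->] := has_top_pow_diff2 n c (has_top_x _) (has_top_y _) j.
  by rewrite nth_default // (leq_trans sP) //; lia.
have top_exp (a : rat) k : (('X - a%:P) ^+ k)`_k = 1.
  have /monicP := monic_exp k (monicXsubC a).
  by rewrite /lead_coef size_exp_XsubC.
have cP : 2%:R * c%:P = 1 :> {poly rat} by exact: (mul2_half (@polyC rat)).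
have nE : (2 + n.-2 = n)%N by lia.
have lhs : (('X - 1) ^+ 2 * (c%:P * top_f3 n))`_n = c * (top_f3 n)`_n.-2.
  rewrite -[X in _`_X = _]nE coefM_top ?coefCM ?top_exp ?mul1r //.
    by rewrite size_exp_XsubC.
  apply: leq_trans sg3; rewrite mul_polyC; exact: size_scale_leq.
have rhs : ('X^n - 2%:R * (c%:P * (1 + 'X)) ^+ n + 1 ^+ n)`_n = 1 - 2%:R * c ^+ n.
  rewrite expr1n coefD coefB coefXn eqxx coef1 gtn_eqF ?addr0; last by lia.
  rewrite -(rmorph_nat (@polyC rat)) exprMn -polyC_exp !coefCM.
  have -> : 1 + 'X = 'X - (-1)%:P :> {poly rat} by rewrite polyCN opprK addrC.
  by rewrite top_exp mulr1.
rewrite /top_f3 -/c in lhs *; rewrite (pow_diff2E n 1 'X cP) lhs in rhs.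
apply/eqP => g0; move: rhs; rewrite -/c g0 mulr0 => /esym/eqP.
rewrite subr_eq0 /c exprVn => /eqP/(congr1 ( *%R^~ (2%:R ^+ n))).
rewrite mul1r mulfVK ?expf_neq0 // -natrX => /eqP.
by rewrite eqr_nat -[X in _ == X]expn1 eqn_exp2l //; lia.
Qed.

(** * Descent to rational coefficients and the degree of F *)

(** A ring morphism from a field preserves sizes of polynomials, so both Sylvester matrices have the
    same shape. *)
Lemma resultant_map_poly (F : fieldType) (S : comNzRingType)
    (f : {rmorphism F -> S}) (p q : {poly F}) : p != 0 -> q != 0 ->
  resultant (map_poly f p) (map_poly f q) = f (resultant p q).
Proof.
move=> /polySpred sp /polySpred sq.
rewrite (resultantE sp sq) (resultantE (d := (size p).-1) (e := (size q).-1));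
  rewrite ?size_map_poly // -det_map_mx.
congr (\det _); apply/matrixP => i j; rewrite !mxE /sylvester_entry.
by case: ifP => _; rewrite coef_map rmorphMn.
Qed.

(* deg(F, x) = (size F).-1 *)
Theorem theorem6 (n : nat) (hn : (3 <= n)%N) :
  (size (resF n)).-1 = ((n - 1) * (n - 2))%N.
Proof.
have n1 : (1 < n)%N by exact: ltnW.
have nz1 : (top_f1 n)`_n.-1 != 0 by rewrite top_f1_lead ?oner_eq0 // ltnW.
have nz3 := top_f3_lead n1.
have coef_neq0 (p : {poly rat}) k : p`_k != 0 -> p != 0.
  by apply: contra => /eqP ->; rewrite coef0.
(* The nonvanishing conditions on the mapped top forms descend to the rationals because [mpolyC] is
   injective. *)
rewrite /resF (size_resultant_top (has_top_f1 n1) (has_top_f3 hn)) /=;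
  rewrite ?coef_map ?mpolyC_eq0 //; first by rewrite subn1 subn2.
rewrite resultant_map_poly ?(coef_neq0 _ _ nz1) ?(coef_neq0 _ _ nz3) //.
rewrite mpolyC_eq0 resultant_eq0.
by have := coprimep_top_f1_f3 (ltnW n1); rewrite coprimep_def => /eqP ->.
Qed.
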